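(* Let $r,R>0$ satisfy $r<\underline{H}(\mathbf{X}|\mathbf{Y})$ and $r+R>\overline{H}(\mathbf{X})$. Then for every $\delta>0$ and all sufficiently large $n$ there exist $A\in\mathcal{A}_n$, $B\in\mathcal{B}_n$ and $\mathbf{c}\in\mathrm{Im}\mathcal{A}_n$ such that \[ \mathrm{Error}(A,B,\mathbf{c},D)\le P\bigl(d_n(X^n,Y^n)>D\bigr)+\delta . \]
   Context: Logarithms base 2. $\mathbf{Y}=\{Y^n\}$ is a general source on an arbitrary alphabet $\mathcal{Y}^n$; the reproduction alphabet is $\mathcal{X}^n$ with $\mathcal{X}$ finite; $d_n:\mathcal{X}^n\times\mathcal{Y}^n\to[0,\infty)$ is a distortion function and $D\ge0$. A conditional distribution $\mu_{X^n|Y^n}$ is given for each $n$, $(X^n,Y^n)$ has joint law $\mu_{X^n|Y^n}(\mathbf{x}|\mathbf{y})\mu_{Y^n}(\mathbf{y})$, and $\mu_{X^n}$ is the resulting marginal. $\overline{H}(\mathbf{X})=\inf\{\theta:\lim_nP(\frac1n\log\frac1{\mu_{X^n}(X^n)}>\theta)=0\}$, $\underline{H}(\mathbf{X}|\mathbf{Y})=\sup\{\theta:\lim_nP(\frac1n\log\frac1{\mu_{X^n|Y^n}(X^n|Y^n)}<\theta)=0\}$. Ensembles and hash property: an ensemble is a sequence $\{(\mathcal{A}_n,p_{\mathsf{A},n})\}$ where $\mathcal{A}_n$ is a set of functions $A:\mathcal{X}^n\to\mathrm{Im}\mathcal{A}_n:=\bigcup_{A\in\mathcal{A}_n}\{A\mathbf{u}:\mathbf{u}\in\mathcal{X}^n\}$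 and $p_{\mathsf{A},n}$ a probability distribution on $\mathcal{A}_n$; it has an $(\boldsymbol\alpha,\boldsymbol\beta)$-hash property if there are sequences $\alpha(n)\to1$, $\beta(n)\to0$ such that for all $n$ and $\mathbf{u}$, $\sum p_{\mathsf{A},n}(\{A:A\mathbf{u}=A\mathbf{u}'\})\le\beta(n)$, summing over $\mathbf{u}'\ne\mathbf{u}$ with $p_{\mathsf{A},n}(\{A:A\mathbf{u}=A\mathbf{u}'\})>\alpha(n)/|\mathrm{Im}\mathcal{A}_n|$. Setting: $\{(\mathcal{A}_n,p_{\mathsf{A},n})\}$, $\{(\mathcal{B}_n,p_{\mathsf{B},n})\}$ are ensembles of functions on $\mathcal{X}^n$, each with some hash property, with $\frac1n\log|\mathrm{Im}\mathcal{A}_n|=r$, $\frac1n\log|\mathrm{Im}\mathcal{B}_n|=R$. $\mathcal{C}_A(\mathbf{c})=\{\mathbf{x}:A\mathbf{x}=\mathbf{c}\}$, $\mathcal{C}_{AB}(\mathbf{c},\mathbf{m})=\{\mathbf{x}:A\mathbf{x}=\mathbf{c},B\mathbf{x}=\mathbf{m}\}$. Stochastic encoder $\Phi_n(\mathbf{y})=B\widetilde{X}$ where $\widetilde{X}$ has distribution $\mu_{X^n|Y^n}(\mathbf{x}|\mathbf{y})/\mu_{X^n|Y^n}(\mathcal{C}_A(\mathbf{c})|\mathbf{y})$ on $\mathcal{C}_A(\mathbf{c})$ (encoding error if $\mu_{X^n|Y^n}(\mathcal{C}_A(\mathbf{c})|\mathbf{y})=0$). Decoder $\psi_n(\mathbf{m})=\arg\max_{\mathbf{x}'\in\mathcal{C}_{AB}(\mathbf{c},\mathbf{m})}\mu_{X^n}(\mathbf{x}')$.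 $\mathrm{Error}(A,B,\mathbf{c},D)=P(d_n(\psi_n(\Phi_n(Y^n)),Y^n)>D)$, with the convention that the distortion is $\infty$ when an encoding error occurs. *)

(* Defs.v *)
From HB Require Import structures.
From mathcomp Require Import all_boot all_order all_algebra.
From mathcomp Require Import all_classical all_reals all_analysis.
Set Implicit Arguments. Unset Strict Implicit. Unset Printing Implicit Defensive.
Import Order.TTheory GRing.Theory Num.Theory numFieldNormedType.Exports.
Local Open Scope classical_set_scope.
Local Open Scope ring_scope.

Definition log2 {R : realType} (x : R) : R := ln x / ln 2.

Definition Xn (X : finType) (n : nat) : finType := {ffun 'I_n -> X}.

Definition imF (U T : finType) (S : {set {ffun U -> T}}) : {set T} :=
  [set (f : {ffun U -> T}) u | f in S, u in [set: U]].

Definition is_ensemble {R : realType} (U T : finType)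
  (S : {set {ffun U -> T}}) (p : {ffun U -> T} -> R) : Prop :=
  (forall f, 0 <= p f) /\ \sum_(f in S) p f = 1.

Definition pcoll {R : realType} (U T : finType)
  (S : {set {ffun U -> T}}) (p : {ffun U -> T} -> R) (u u' : U) : R :=
  \sum_(f in S | f u == f u') p f.

Definition hash_property {R : realType} (U T : nat -> finType)
  (S : forall n, {set {ffun U n -> T n}}) (p : forall n, {ffun U n -> T n} -> R)
  (alpha beta : nat -> R) : Prop :=
  [/\ alpha n @[n --> \oo] --> (1 : R),
      beta n @[n --> \oo] --> (0 : R) &
      forall n (u : U n),
        \sum_(u' : U n | (u' != u) &&
               (alpha n / (#|imF (S n)|)%:R < pcoll (S n) (p n) u u'))
           pcoll (S n) (p n) u u' <= beta n].

Definition has_hash_property {R : realType} (U T : nat -> finType)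
  (S : forall n, {set {ffun U n -> T n}}) (p : forall n, {ffun U n -> T n} -> R) : Prop :=
  exists alpha beta : nat -> R, hash_property S p alpha beta.

(* P((X^n,Y^n) in E) for the joint law mu_{X^n|Y^n}(x|y) mu_{Y^n}(dy) *)
Definition jointP {R : realType} (X : finType) (dY : nat -> measure_display)
  (TY : forall n, measurableType (dY n)) (PY : forall n, probability (TY n) R)
  (W : forall n, TY n -> Xn X n -> R) (n : nat) (E : Xn X n -> TY n -> bool) : \bar R :=
  (\int[PY n]_y (\sum_(x : Xn X n) W n y x * (E x y)%:R)%:E)%E.

Definition muX {R : realType} (X : finType) (dY : nat -> measure_display)
  (TY : forall n, measurableType (dY n)) (PY : forall n, probability (TY n) R)
  (W : forall n, TY n -> Xn X n -> R) (n : nat) (x : Xn X n) : R :=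
  fine (\int[PY n]_y (W n y x)%:E)%E.

Definition Hbar {R : realType} (X : finType) (dY : nat -> measure_display)
  (TY : forall n, measurableType (dY n)) (PY : forall n, probability (TY n) R)
  (W : forall n, TY n -> Xn X n -> R) : \bar R :=
  ereal_inf [set (th%:E)%E | th in
    [set th : R | jointP (n:=n) PY W (fun (x : Xn X n) _ => th < n%:R^-1 * log2 (muX (n:=n) PY W x)^-1)
                    @[n --> \oo] --> (0 : \bar R)]].

Definition Hlow {R : realType} (X : finType) (dY : nat -> measure_display)
  (TY : forall n, measurableType (dY n)) (PY : forall n, probability (TY n) R)
  (W : forall n, TY n -> Xn X n -> R) : \bar R :=
  ereal_sup [set (th%:E)%E | th in
    [set th : R | jointP (n:=n) PY W (fun x y => n%:R^-1 * log2 (W n y x)^-1 < th)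
                    @[n --> \oo] --> (0 : \bar R)]].

(* decoder psi_n(m) = argmax_{x' in C_AB(c,m)} mu_{X^n}(x');
   None if C_AB(c,m) is empty (never happens for messages produced by the encoder);
   ties are broken by MathComp's Order.arg_max. *)
Definition decoder {R : realType} (X : finType) (dY : nat -> measure_display)
  (TY : forall n, measurableType (dY n)) (PY : forall n, probability (TY n) R)
  (W : forall n, TY n -> Xn X n -> R) (n : nat) (TA TB : finType)
  (A : {ffun Xn X n -> TA}) (B : {ffun Xn X n -> TB}) (c : TA) (m : TB)
  : option (Xn X n) :=
  match [pick x | (A x == c) && (B x == m)] with
  | Some x0 => Some (Order.arg_max x0 (fun x => (A x == c) && (B x == m))
                                     (fun x => muX PY W x))
  | None => None
  end.

(* conditional probability, given Y^n = y, that d_n(psi_n(Phi_n(y)), y) > D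
   (equal to 1 when an encoding error occurs: mu_{X^n|Y^n}(C_A(c)|y) = 0) *)
Definition err_given {R : realType} (X : finType) (dY : nat -> measure_display)
  (TY : forall n, measurableType (dY n)) (PY : forall n, probability (TY n) R)
  (W : forall n, TY n -> Xn X n -> R) (dist : forall n, Xn X n -> TY n -> R)
  (n : nat) (TA TB : finType) (A : {ffun Xn X n -> TA}) (B : {ffun Xn X n -> TB})
  (c : TA) (D : R) (y : TY n) : R :=
  let mass := \sum_(x : Xn X n | A x == c) W n y x in
  if mass == 0 then 1 else
  \sum_(x : Xn X n | A x == c)
     (W n y x / mass) *
     match decoder PY W A B c (B x) with
     | Some x' => if D < dist n x' y then 1 else 0
     | None => 1
     end.

Definition Error {R : realType} (X : finType) (dY : nat -> measure_display)
  (TY : forall n, measurableType (dY n)) (PY : forall n, probability (TY n) R)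
  (W : forall n, TY n -> Xn X n -> R) (dist : forall n, Xn X n -> TY n -> R)
  (n : nat) (TA TB : finType) (A : {ffun Xn X n -> TA}) (B : {ffun Xn X n -> TB})
  (c : TA) (D : R) : \bar R :=
  (\int[PY n]_y (err_given PY W dist A B c D y)%:E)%E.

(* Main.v *)
(* Random coding: average over A and B drawn from the ensembles and c uniform
   on Im A, of size M. If q is the conditional mass of the bin C_A(c) given y,
   the error given y is at most |1 - M q| plus M times the sum, over x in the
   bin, of mu(x|y) [the decoder applied to (c, B x) has distortion > D].

   Averaged over c, the second term is the probability under the original
   joint law that the decoder, fed with (A x, B x), has distortion > D, hence
   at most P(d > D) plus the probability that some other x' at least as likely
   as x collides with x under both A and B. There are at most 1 / mu(x) such
   x', so r + R > Hbar and the hash property make the latter vanish.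

   For the first term, discard the x with mu(x|y) > 2^(-n th), where
   r < th < Hlow. The second moment of the mass of the remaining part of the
   bin is controlled by the collision probabilities of A, so that M q
   concentrates around 1. *)
Require Import Defs.
From HB Require Import structures.
From mathcomp Require Import all_boot all_order all_algebra.
From mathcomp Require Import all_classical all_reals all_analysis.
From mathcomp Require Import measurable_realfun ring lra.
Import Order.TTheory GRing.Theory Num.Theory numFieldNormedType.Exports.
Set Implicit Arguments. Unset Strict Implicit. Unset Printing Implicit Defensive.
Local Open Scope classical_set_scope.
Local Open Scope ring_scope.

(** * Integrals over the source alphabet *)

Lemma integral_cst_probability {R : realType} d (T : measurableType d)
    (P : probability T R) (c : R) : (\int[P]_y c%:E = c%:E)%E.
Proof.
rewrite integral_cst//.
transitivity (c%:E * 1)%E; last by rewrite mule1.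
by congr (_ * _)%E; exact: probability_setT.
Qed.

(** First-moment method: the index of least integral does at least as well as the weighted mean, and
    the weighted mean passes under the integral because all terms are nonnegative. Everything stays
    in [\bar R], so no integrability is required. *)
Lemma exists_le_weighted_mean {R : realType} d (T : measurableType d)
    (P : probability T R) (I : finType) (Q : pred I) (wt : I -> R)
    (f : I -> T -> R) (g : T -> R) :
  (forall i, 0 <= wt i) -> \sum_(i | Q i) wt i = 1 ->
  (forall i y, 0 <= f i y) -> (forall i, measurable_fun setT (f i)) ->
  measurable_fun setT g ->
  (forall y, \sum_(i | Q i) wt i * f i y <= g y) ->
  exists2 i, Q i & (\int[P]_y (f i y)%:E <= \int[P]_y (g y)%:E)%E.
Proof.
move=> wt0 wt1 f0 mf mg fg.
pose e i := (\int[P]_y (f i y)%:E)%E.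
have e0 i : (0 <= e i)%E by apply: integral_ge0 => y _; rewrite lee_fin.
have [i0 Qi0 _] : exists2 i, Q i & 0 < wt i.
  have /psumr_neq0P : \sum_(i | Q i) wt i <> 0 by rewrite wt1; apply/eqP/oner_neq0.
  by move=> /(_ (fun i _ => wt0 i)) [i /andP[? ?]]; exists i.
have [i Qi imin] := Order.TotalTheory.arg_minP e Qi0; exists i => //.
rewrite -[leLHS]mul1e -wt1 -sumEFin ge0_sume_distrl; last by move=> j _; rewrite lee_fin.
apply: (@le_trans _ _ (\sum_(j | Q j) (wt j)%:E * e j)%E).
  by apply: lee_sum => j Qj; rewrite lee_wpmul2l ?lee_fin ?imin.
have -> : (\sum_(j | Q j) (wt j)%:E * e j = \int[P]_y (\sum_(j | Q j) (wt j * f j y))%:E)%E.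
  under eq_integral => y _ do rewrite -sumEFin -big_filter.
  rewrite ge0_integral_sum//.
  - rewrite big_filter; apply: eq_bigr => j _.
    under eq_integral => y _ do rewrite EFinM.
    rewrite ge0_integralZl_EFin//; last exact/measurable_EFinP.
    by move=> y _; rewrite lee_fin.
  - by move=> j; apply/measurable_EFinP; apply: measurable_funM.
  - by move=> j y _; rewrite lee_fin mulr_ge0.
apply: ge0_le_integral => //.
- by move=> y _; rewrite lee_fin sumr_ge0// => j _; rewrite mulr_ge0.
- apply/measurable_EFinP; under eq_fun do rewrite -big_filter.
  by apply: measurable_sum => j; apply: measurable_funM.
- exact/measurable_EFinP.
- by move=> y _; rewrite lee_fin.
Qed.

Lemma ge0_integralD_EFin {R : realType} d (T : measurableType d)
    (m : {measure set T -> \bar R}) (f g : T -> R) :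
  (forall y, 0 <= f y) -> (forall y, 0 <= g y) ->
  measurable_fun setT f -> measurable_fun setT g ->
  (\int[m]_y (f y + g y)%:E = \int[m]_y (f y)%:E + \int[m]_y (g y)%:E)%E.
Proof.
move=> f0 g0 mf mg; under eq_integral => y _ do rewrite EFinD.
rewrite ge0_integralD// => [y _| |y _|]; rewrite ?lee_fin//; exact/measurable_EFinP.
Qed.

Lemma measurable_natr_bool {R : realType} d (T : measurableType d) (h : T -> bool) :
  measurable_fun setT h -> measurable_fun setT (fun y => (h y)%:R : R).
Proof.
move=> mh; have -> : (fun y => (h y)%:R : R) = (fun y => if h y then 1 else 0).
  by apply/funext => y; case: (h y).
exact: measurable_fun_ifT.
Qed.
(** This is [(eta - |t|) ^ 2 >= 0] divided by [2 * eta]. It trades a first absolute moment for a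
    second moment, at the price of the constant [eta / 2]. *)
Lemma norm_le_sqr {R : realFieldType} (t eta : R) : 0 < eta ->
  `|t| <= eta / 2 + t ^+ 2 / (2 * eta).
Proof.
move=> eta0; have -> : eta / 2 + t ^+ 2 / (2 * eta) = (eta ^+ 2 + `|t| ^+ 2) / (2 * eta).
  by rewrite real_normK ?num_real//; field; rewrite gt_eqF.
rewrite ler_pdivlMr ?mulr_gt0//; have := sqr_ge0 (eta - `|t|); nra.
Qed.

(** * Consequences of the hash property for one ensemble *)

(** The last clause of [hash_property] at one blocklength, with the values of [alpha] and [beta]
    frozen as the numbers [a] and [b]. *)
Definition hash_bound {R : realType} (U T : finType) (S : {set {ffun U -> T}})
    (p : {ffun U -> T} -> R) (a b : R) : Prop :=
  forall u : U, \sum_(u' : U | (u' != u) &&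
      (a / (#|imF S|)%:R < pcoll S p u u')) pcoll S p u u' <= b.

Section Ensemble.
Context {R : realType} {U T : finType}.
Variables (S : {set {ffun U -> T}}) (p : {ffun U -> T} -> R) (a b : R).
Hypotheses (ensS : is_ensemble S p) (a_ge0 : 0 <= a)
  (hashS : hash_bound S p a b).

Local Notation pc := (pcoll S p).
Local Notation M := ((#|imF S|)%:R : R).

Lemma imF_mem f u : f \in S -> f u \in imF S.
Proof. by move=> fS; apply/imset2P; exists f u; rewrite ?inE. Qed.

Lemma pcoll_ge0 u u' : 0 <= pc u u'.
Proof. by apply: sumr_ge0 => f _; apply: ensS.1. Qed.

Lemma pcoll_le1 u u' : pc u u' <= 1.
Proof.
rewrite -ensS.2 /pcoll [leRHS](bigID (fun f : {ffun U -> T} => f u == f u')) /=.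
by rewrite lerDl sumr_ge0// => f _; apply: ensS.1.
Qed.

(** Raising the threshold leaves fewer nonnegative terms in the sum. Since [alpha n] tends to 1 but
    may be negative for some [n], this is how the condition [0 <= a] is secured. *)
Lemma hash_bound_norm (a' : R) : `|a'| = a -> hash_bound S p a' b ->
  hash_bound S p a b.
Proof.
move=> aE hS u; apply: le_trans _ (hS u).
rewrite [leLHS]big_mkcond [leRHS]big_mkcond /=; apply: ler_sum => u' _.
case: (u' != u) => //=; case: ifPn => [h|_]; last first.
  by case: ifP => _ //; apply: pcoll_ge0.
rewrite ifT// (le_lt_trans _ h)// ler_wpM2r ?invr_ge0//.
by rewrite -aE ler_norm.
Qed.

(** Three kinds of points: [u] itself costs at most [k]; those colliding with [u] with probability
    above [a / M] cost at most [b * k] together; each other [x] costs at most [a / M * h x]. *)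
Lemma pcoll_sum_le (h : U -> R) (k : R) u : (forall x, 0 <= h x <= k) ->
  \sum_x h x * pc u x <= (1 + b) * k + a / M * \sum_x h x.
Proof.
move=> h01.
have k0 : 0 <= k by case/andP: (h01 u) => /le_trans; apply.
have aM : 0 <= a / M by rewrite divr_ge0.
rewrite (bigD1 u) //= mulrDl mul1r -addrA lerD //.
  case/andP: (h01 u) => h0 hk; apply: le_trans hk.
  by rewrite ler_piMr ?pcoll_le1.
have -> : b * k = k * b by rewrite mulrC.
apply: le_trans (lerD (ler_wpM2l k0 (hashS u)) (lexx _)).
rewrite [X in _ + a / M * X](bigD1 u) //= mulrDr addrA -[leLHS]addr0 addrAC.
apply: lerD; last by rewrite mulr_ge0//; case/andP: (h01 u).
rewrite mulr_sumr big_mkcondr /= mulr_sumr -big_split /=.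
apply: ler_sum => x _; case/andP: (h01 x) => h0 hk.
case: ifPn => [_|]; last by rewrite -leNgt => le; rewrite add0r mulrC ler_wpM2r.
by rewrite -[leLHS]addr0 lerD ?mulr_ge0// ler_wpM2r ?pcoll_ge0.
Qed.

Lemma sum_fibers (f : {ffun U -> T}) (P : pred U) (h : U -> R) : f \in S ->
  \sum_(c in imF S) \sum_(x | P x && (f x == c)) h x = \sum_(x | P x) h x.
Proof.
by move=> fS; rewrite (partition_big f (mem (imF S))) // => x _; apply: imF_mem.
Qed.

(* The bin of [x] has expected second moment [pc], so a Chebyshev-type
   bound, via [`|t| <= eta / 2 + t ^ 2 / (2 eta)], shows that the bins of a
   random [f] carry nearly equal mass. *)
Lemma saturation (w : U -> R) (G : pred U) (k eta : R) :
  (forall x, 0 <= w x) -> \sum_x w x = 1 -> (forall x, G x -> w x <= k) ->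
  0 <= k -> 0 < eta -> 0 < M ->
  \sum_(f in S) p f * (M^-1 * \sum_(c in imF S)
     `|1 - M * \sum_(x | f x == c) w x|) <=
  eta / 2 + (\sum_(x | ~~ G x) w x + `|a - 1| + (1 + b) * (M * k)) / (2 * eta)
   + \sum_(x | ~~ G x) w x.
Proof.
move=> w0 w1 wk k0 eta0 M0.
pose q (f : {ffun U -> T}) (c : T) := \sum_(x | G x && (f x == c)) w x.
pose wG := \sum_(x | G x) w x; set wN := \sum_(x | ~~ G x) w x.
have wGN : wG + wN = 1 by rewrite -w1 [RHS](bigID G).
have wG0 : 0 <= wG by apply: sumr_ge0.
have wN0 : 0 <= wN by apply: sumr_ge0.
have Mu : M != 0 by rewrite gt_eqF.
(* For fixed [f], the triangle inequality splits off the mass outside [G], and [norm_le_sqr] is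
   applied to [1 - M * q f c]. On summing over [c], the squares [q f c ^ 2] become the sum of
   [w x * w x'] over pairs in [G] that collide under [f]. *)
have step f : f \in S -> M^-1 * (\sum_(c in imF S)
     `|1 - M * \sum_(x | f x == c) w x|) <= eta / 2 + wN +
     (1 - 2 * wG + M * \sum_(x | G x) \sum_(x' | G x' && (f x' == f x)) w x * w x') / (2 * eta).
  move=> fS.
  have le1 c : `|1 - M * \sum_(x | f x == c) w x| <=
      eta / 2 + (1 - 2 * (M * q f c) + M ^+ 2 * (q f c * q f c)) / (2 * eta)
      + M * \sum_(x | ~~ G x && (f x == c)) w x.
    have -> : \sum_(x | f x == c) w x = q f c + \sum_(x | ~~ G x && (f x == c)) w x.
      rewrite (bigID G) /=; congr (_ + _); apply: eq_bigl => x; exact: andbC.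
    rewrite mulrDr opprD [X in `|X|]addrA.
    apply: le_trans (ler_normB _ _) _.
    rewrite [X in _ + X]ger0_norm; last by rewrite mulr_ge0 ?ler0n// sumr_ge0.
    rewrite lerD2r; set t := M * q f c.
    have -> : 1 - 2 * t + M ^+ 2 * (q f c * q f c) = (1 - t) ^+ 2 by rewrite /t; ring.
    exact: norm_le_sqr.
  have -> : 1 - 2 * wG + M * (\sum_(x | G x) \sum_(x' | G x' && (f x' == f x)) w x * w x')
     = M^-1 * \sum_(c in imF S) (1 - 2 * (M * q f c) + M ^+ 2 * (q f c * q f c)).
    rewrite big_split /= big_split /= sumr_const sumrN -!mulr_sumr (sum_fibers _ _ fS).
    rewrite -[X in _ = _ * (X - _ + _)]/M -/wG.
    have -> : \sum_(c in imF S) q f c * q f c =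
        \sum_(x | G x) \sum_(x' | G x' && (f x' == f x)) w x * w x'.
      rewrite -(sum_fibers _ _ fS); apply: eq_bigr => c _.
      rewrite /q mulr_suml; apply: eq_bigr => x /andP[_ /eqP <-].
      by rewrite mulr_sumr.
    by field.
  have -> : eta / 2 + wN = M^-1 * \sum_(c in imF S)
      (eta / 2 + M * \sum_(x | ~~ G x && (f x == c)) w x).
    by rewrite big_split /= sumr_const -mulr_sumr (sum_fibers _ _ fS) -/wN -mulr_natr; field.
  rewrite -mulrA -mulrDr ler_pM2l ?invr_gt0// mulr_suml -big_split /=.
  by apply: ler_sum => c _; rewrite [leRHS]addrAC.
apply: (@le_trans _ _ (\sum_(f in S) p f * (eta / 2 + wN +
     (1 - 2 * wG + M * \sum_(x | G x) \sum_(x' | G x' && (f x' == f x)) w x * w x') / (2 * eta)))).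
  by apply: ler_sum => f fS; rewrite ler_wpM2l ?ensS.1 ?step.
(* Averaging over [f] turns the indicator of a collision into [pcoll]. *)
have -> : \sum_(f in S) p f * (eta / 2 + wN +
     (1 - 2 * wG + M * \sum_(x | G x) \sum_(x' | G x' && (f x' == f x)) w x * w x') / (2 * eta))
   = eta / 2 + wN + (1 - 2 * wG + M * \sum_(x | G x) w x * \sum_(x' | G x') w x' * pcoll S p x x') / (2 * eta).
  under eq_bigr => f _ do rewrite mulrDr.
  rewrite big_split /= -mulr_suml ensS.2 mul1r; congr (_ + _).
  under eq_bigr => f _ do rewrite mulrA mulrDr.
  rewrite -mulr_suml big_split /= -mulr_suml ensS.2 mul1r; congr ((_ + _) / _).
  under eq_bigr => f _ do rewrite mulrCA.
  rewrite -mulr_sumr; congr (_ * _).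
  under [LHS]eq_bigr => f _ do rewrite mulr_sumr.
  rewrite [LHS]exchange_big /=; apply: eq_bigr => x _.
  under [LHS]eq_bigr => f _ do rewrite mulr_sumr big_mkcondr.
  rewrite [LHS]exchange_big /= mulr_sumr; apply: eq_bigr => x' _.
  rewrite /pcoll big_mkcondr /= !mulr_sumr; apply: eq_bigr => f _.
  by rewrite eq_sym; case: ifP => _; rewrite ?mulr0//; ring.
rewrite -addrA [X in _ + X]addrC addrA lerD2r lerD2l.
apply: ler_wpM2r; first by rewrite invr_ge0 mulr_ge0 ?ltW.
have key x : \sum_(x' | G x') w x' * pcoll S p x x' <= (1 + b) * k + a / M * wG.
  pose h x' := if G x' then w x' else 0.
  have -> : \sum_(x' | G x') w x' * pcoll S p x x' = \sum_x' h x' * pcoll S p x x'.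
    by rewrite big_mkcond; apply: eq_bigr => x' _; rewrite /h; case: ifP; rewrite ?mul0r.
  have -> : wG = \sum_x' h x' by rewrite /wG big_mkcond.
  by apply: pcoll_sum_le => x'; rewrite /h; case: ifPn => [/wk ->|_]; rewrite ?w0 ?lexx.
(* [hash_bound] speaks of points of [U], so it yields [0 <= b] only once a point is at hand; the
   weights sum to 1, so there is one. *)
have [x0 _] : exists x, 0 < w x.
  have /psumr_neq0P : \sum_(x : U) w x <> 0 by rewrite w1; apply/eqP/oner_neq0.
  by move=> /(_ (fun i _ => w0 i)) [x /= xw]; exists x.
have b1k : 0 <= (1 + b) * k.
  rewrite mulr_ge0// addr_ge0//; apply: le_trans _ (hashS x0).
  by apply: sumr_ge0 => ? _; apply: pcoll_ge0.
have {key} : \sum_(x | G x) w x * \sum_(x' | G x') w x' * pcoll S p x x' <=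
    wG * ((1 + b) * k + a / M * wG).
  by rewrite mulr_suml; apply: ler_sum => x _; rewrite ler_wpM2l.
move/(ler_wpM2l (ltW M0)) => key.
apply: le_trans (lerD (lexx _) key) _.
(* Completing the square: [1 - 2 * wG + a * wG ^ 2] is [(1 - wG) ^ 2 + (a - 1) * wG ^ 2], and
   [1 - wG] is [wN]. The three terms are then bounded separately, using that [wG] and [wN] are at
   most 1. *)
have -> : 1 - 2 * wG + M * (wG * ((1 + b) * k + a / M * wG)) =
  wN ^+ 2 + (a - 1) * wG ^+ 2 + wG * ((1 + b) * (M * k)).
  have -> : wN = 1 - wG by rewrite -wGN addrAC subrr add0r.
  by field.
have wG1 : wG <= 1 by rewrite -wGN lerDl.
have wN1 : wN <= 1 by rewrite -wGN lerDr.
apply: lerD; first apply: lerD.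
- by rewrite expr2 ler_piMl.
- apply: le_trans (ler_norm _) _; rewrite normrM ler_piMr//.
  by rewrite ger0_norm ?exprn_ge0// exprn_ile1.
- by rewrite ler_piMl// mulrCA mulr_ge0.
Qed.

End Ensemble.

(** * Simultaneous collisions under two independent functions *)

Section Collision.
Context {R : realType} {U TA TB : finType}.
Variables (SA : {set {ffun U -> TA}}) (pA : {ffun U -> TA} -> R) (aA bA : R).
Variables (SB : {set {ffun U -> TB}}) (pB : {ffun U -> TB} -> R) (aB bB : R).
Hypotheses (ensA : is_ensemble SA pA) (ensB : is_ensemble SB pB).
Hypotheses (aA_ge0 : 0 <= aA) (aB_ge0 : 0 <= aB).
Hypotheses (hashA : hash_bound SA pA aA bA) (hashB : hash_bound SB pB aB bB).

Definition collides (G : pred U) (A : {ffun U -> TA}) (B : {ffun U -> TB}) (u : U) : bool :=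
  [exists u', [&& u' != u, G u', A u == A u' & B u == B u']].

(** Points whose collision probability with [u] is above the threshold for [A] contribute at most
    [bA] in all, the other factor being at most 1; likewise [bB] for [B]. Each remaining point of
    [G] contributes at most the product of the two thresholds. *)
Lemma collision_prob_le (G : pred U) (u : U) :
  \sum_(A in SA) \sum_(B in SB) pA A * pB B * (collides G A B u)%:R <=
  bA + bB + aA / (#|imF SA|)%:R * (aB / (#|imF SB|)%:R) * #|G|%:R.
Proof.
have pA0 := ensA.1; have pB0 := ensB.1.
pose P u' := (u' != u) && G u'.
(* Union bound over [u']; as [A] and [B] are drawn independently, the probability of colliding under
   both is a product. *)
apply: (@le_trans _ _ (\sum_(u' | P u') pcoll SA pA u u' * pcoll SB pB u u')).
  have -> : \sum_(u' | P u') pcoll SA pA u u' * pcoll SB pB u u' =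
    \sum_(A in SA) \sum_(B in SB) \sum_(u' | P u')
      pA A * pB B * ((A u == A u') && (B u == B u'))%:R.
    under [RHS]eq_bigr => A _ do rewrite exchange_big /=.
    rewrite [RHS]exchange_big /=; apply: eq_bigr => u' _.
    rewrite /pcoll big_mkcondr mulr_suml; apply: eq_bigr => A _.
    rewrite big_mkcondr mulr_sumr; apply: eq_bigr => B _.
    by case: eqP => _; case: eqP => _; rewrite ?mulr0 ?mul0r ?mulr1.
  apply: ler_sum => A _; apply: ler_sum => B _; rewrite -mulr_sumr.
  apply: ler_wpM2l; first exact: mulr_ge0.
  case: (boolP (collides _ _ _ _)) => [/existsP[u' /and4P[u'u Gu' Au Bu]]|_]; last first.
    exact: sumr_ge0.
  by rewrite (bigD1 u') /= ?/P ?u'u// Au Bu lerDl sumr_ge0.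
set gA := aA / _; set gB := aB / _.
have gA0 : 0 <= gA by rewrite divr_ge0.
have gB0 : 0 <= gB by rewrite divr_ge0.
apply: le_trans (_ : _ <= \sum_(u' | u' != u) ((if gA < pcoll SA pA u u' then pcoll SA pA u u' else 0)
   + (if gB < pcoll SB pB u u' then pcoll SB pB u u' else 0)) + \sum_(u' | G u') gA * gB) _.
  rewrite /P big_mkcondr [X in _ + X]big_mkcond /=.
  apply: le_trans (_ : _ <= \sum_(u' | u' != u) ((if gA < pcoll SA pA u u' then pcoll SA pA u u' else 0)
   + (if gB < pcoll SB pB u u' then pcoll SB pB u u' else 0)) + 
    \sum_(u' | u' != u) (if G u' then gA * gB else 0)) _; last first.
    rewrite lerD2l [leRHS](bigD1 u) //= lerDr; case: ifP => // _; exact: mulr_ge0.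
  rewrite -big_split /=; apply: ler_sum => u' _.
  have := pcoll_ge0 ensA u u'; have := pcoll_ge0 ensB u u'.
  have := pcoll_le1 ensA u u'; have := pcoll_le1 ensB u u'.
  move: (pcoll SA pA u u') (pcoll SB pB u u') => x y y1 x1 y0 x0.
  case: (G u'); last by rewrite addr0 addr_ge0//; case: ifP.
  case: ltP => hA.
    rewrite -[leLHS]addr0 -addrA lerD ?ler_piMr// addr_ge0 ?mulr_ge0//; case: ifP => //.
  case: ltP => hB; first by rewrite add0r -[leLHS]addr0 lerD ?ler_piMl ?mulr_ge0.
  by rewrite !add0r ler_pM.
rewrite big_split /= -!big_mkcondr /= lerD ?lerD//.
by rewrite sumr_const mulr_natr.
Qed.

End Collision.

(** * Random coding at a fixed blocklength *)

(** With [m] the mass and [s] the weighted error, [s / m = (1 - M * m) * (s / m) + M * s] and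
    [0 <= s / m <= 1]. The division by the mass thus disappears, and an encoding error ([m = 0]) is
    paid for by the first term, which is then 1. *)
Lemma conditional_sum_le {R : realFieldType} (U : finType) (P : pred U) (w e : U -> R) (M : R) :
  (forall x, 0 <= w x) -> (forall x, 0 <= e x <= 1) -> 0 <= M ->
  (let mass := \sum_(x | P x) w x in
   if mass == 0 then 1 else \sum_(x | P x) w x / mass * e x) <=
  `|1 - M * \sum_(x | P x) w x| + M * \sum_(x | P x) w x * e x.
Proof.
move=> w0 e01 M0 /=; set m := \sum_(x | P x) w x; set s := \sum_(x | P x) w x * e x.
have s0 : 0 <= s by apply: sumr_ge0 => x _; rewrite mulr_ge0//; case/andP: (e01 x).
have sm : s <= m by apply: ler_sum => x _; rewrite ler_piMr//; case/andP: (e01 x).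
case: eqP => [->|/eqP m0]; first by rewrite mulr0 subr0 normr1 lerDl mulr_ge0.
have mp : 0 < m by rewrite lt0r m0 (le_trans s0).
have -> : \sum_(x | P x) w x / m * e x = s / m.
  by rewrite /s mulr_suml; apply: eq_bigr => x _; rewrite mulrAC.
have -> : s / m = (1 - M * m) * (s / m) + M * s by field.
rewrite lerD2r; apply: le_trans (ler_norm _) _; rewrite normrM ler_piMr//.
rewrite ger0_norm; first by rewrite ler_pdivrMr ?mul1r.
by rewrite divr_ge0// ltW.
Qed.

Section FixedBlocklength.
Context {R : realType} {X : finType} {dY : nat -> measure_display}.
Context {TY : forall n, measurableType (dY n)} {PY : forall n, probability (TY n) R}.
Variable W : forall n, TY n -> Xn X n -> R.
Arguments W : clear implicits.
Hypotheses (W_ge0 : forall n y x, 0 <= W n y x).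
Hypotheses (W_sum1 : forall n y, \sum_(x : Xn X n) W n y x = 1).
Hypothesis W_meas : forall n x, measurable_fun setT (fun y => W n y x).
Variable dist : forall n, Xn X n -> TY n -> R.
Arguments dist : clear implicits.
Hypothesis dist_meas : forall n x, measurable_fun setT (dist n x).
Variables (n : nat) (TA TB : finType) (D : R).

Local Notation mu := (muX (n:=n) PY W).
Local Notation likelier x := [pred x' | mu x <= mu x'].

(** The bin searched contains [x], so the maximizer exists and is at least as likely as [x]; if it
    differs from [x], it is a collision. Nothing depends on how ties are broken. *)
Lemma decoderP (A : {ffun Xn X n -> TA}) (B : {ffun Xn X n -> TB}) x :
  exists2 x', decoder PY W A B (A x) (B x) = Some x' &
    (x' == x) || collides (likelier x) A B x.
Proof.
rewrite /decoder; case: pickP => [x0 x0P|/(_ x)]; last by rewrite !eqxx.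
eexists; first reflexivity.
case: Order.TotalTheory.arg_maxP => // x' /andP[Ax' Bx'] xmax.
case: eqP => //= /eqP x'x; apply/existsP; exists x'.
apply/and4P; split; rewrite 1?[A x == _]eq_sym 1?[B x == _]eq_sym//.
by apply: xmax; rewrite !eqxx.
Qed.

Lemma err_given_ge0 (A : {ffun Xn X n -> TA}) (B : {ffun Xn X n -> TB}) (c : TA) y : 0 <= err_given PY W dist A B c D y.
Proof.
rewrite /err_given; case: ifP => // _; apply: sumr_ge0 => x _.
rewrite mulr_ge0 ?divr_ge0 ?sumr_ge0//.
by case: decoder => [x'|] //; case: ifP.
Qed.

Lemma measurable_err_given (A : {ffun Xn X n -> TA}) (B : {ffun Xn X n -> TB}) (c : TA) :
  measurable_fun setT (err_given PY W dist A B c D).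
Proof.
have mmass : measurable_fun setT (fun y : TY n => \sum_(x | A x == c) W n y x).
  by under eq_fun do rewrite big_mkcond; apply: measurable_sum => x /=; case: (A x == c).
apply: measurable_fun_ifT => //.
  exact: measurable_fun_eqr.
under eq_fun do rewrite big_mkcond; apply: measurable_sum => x /=; case: (A x == c) => //.
apply: measurable_funM.
  apply: measurable_funM => //.
  (* The inverse is written as a power, which is measurable on the whole line; on nonnegative reals
     the two agree, even at 0. *)
  have -> : (fun y : TY n => (\sum_(x | A x == c) W n y x)^-1) =
      (fun y => (\sum_(x | A x == c) W n y x) `^ (-1)).
    by apply/funext => y; rewrite powR_inv1// sumr_ge0.
  exact: measurableT_comp (measurable_powR _) mmass.
case: decoder => [x'|] //.
apply: measurable_fun_ifT => //.
exact: measurable_fun_ltr.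
Qed.

Variables (SA : {set {ffun Xn X n -> TA}}) (pA : {ffun Xn X n -> TA} -> R).
Variables (SB : {set {ffun Xn X n -> TB}}) (pB : {ffun Xn X n -> TB} -> R).
Hypotheses (ensA : is_ensemble SA pA) (ensB : is_ensemble SB pB).
Local Notation MA := ((#|imF SA|)%:R : R).
Hypothesis MA_gt0 : 0 < MA.

(** For fixed [A] and [B], [conditional_sum_le] with factor [MA] replaces the encoder's conditional
    law by [W n y]. The bins of [A] partition the space, so the sum over [c] becomes a sum over all
    [x] with [c] equal to [A x], where [decoderP] applies. *)
Lemma mean_err_given_le (y : TY n) :
  \sum_(A in SA) \sum_(B in SB) \sum_(c in imF SA)
     pA A * pB B * MA^-1 * err_given PY W dist A B c D y <=
  \sum_(A in SA) pA A * (MA^-1 * \sum_(c in imF SA)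
     `|1 - MA * \sum_(x | A x == c) W n y x|) +
  \sum_x W n y x * (D < dist n x y)%R%:R +
  \sum_x W n y x * \sum_(A in SA) \sum_(B in SB)
     pA A * pB B * (collides (likelier x) A B x)%:R.
Proof.
have pA0 := ensA.1; have pB0 := ensB.1.
pose e (A : {ffun Xn X n -> TA}) (B : {ffun Xn X n -> TB}) (c : TA) (x : Xn X n) : R :=
  match decoder PY W A B c (B x) with
  | Some x' => if D < dist n x' y then 1 else 0 | None => 1 end.
have e01 A (B : {ffun Xn X n -> TB}) c x : 0 <= e A B c x <= 1.
  by rewrite /e; case: decoder => [x'|]; rewrite ?ler01 ?lexx//; case: ifP; rewrite ?ler01 ?lexx.
have eA A (B : {ffun Xn X n -> TB}) x : e A B (A x) x <= (D < dist n x y)%R%:R + (collides (likelier x) A B x)%:R.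
  rewrite /e; have [x' -> /orP[/eqP ->|->]] := decoderP A B x.
    by case: ifP => _; rewrite ?lerDl// addr_ge0.
  by case: ifP => _; rewrite ?lerDr// addr_ge0.
pose a A := MA^-1 * \sum_(c in imF SA) `|1 - MA * \sum_(x | A x == c) W n y x|.
have step A (B : {ffun Xn X n -> TB}) : A \in SA ->
    \sum_(c in imF SA) MA^-1 * err_given PY W dist A B c D y <=
    a A + \sum_x W n y x * (D < dist n x y)%R%:R +
     \sum_x W n y x * (collides (likelier x) A B x)%:R.
  move=> AS.
  apply: (@le_trans _ _ (a A + \sum_x W n y x * e A B (A x) x)); last first.
    rewrite -addrA lerD2l -big_split /=; apply: ler_sum => x _.
    by rewrite -mulrDr ler_wpM2l.
  have -> : a A + \sum_x W n y x * e A B (A x) x = \sum_(c in imF SA)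
      MA^-1 * (`|1 - MA * \sum_(x | A x == c) W n y x| +
                MA * \sum_(x | A x == c) W n y x * e A B c x).
    rewrite -mulr_sumr big_split /= mulrDr; congr (_ + _).
    rewrite -mulr_sumr mulrA mulVf ?mul1r ?gt_eqF//.
    rewrite (partition_big A (mem (imF SA))) => [|x _]; last exact: imF_mem.
    by apply: eq_bigr => c _; apply: eq_bigr => x /eqP ->.
  apply: ler_sum => c _; rewrite ler_pM2l ?invr_gt0//.
  exact: (@conditional_sum_le _ _ (fun x => A x == c) (W n y) (e A B c)).
pose d : R := \sum_x W n y x * (D < dist n x y)%R%:R.
pose g (A : {ffun Xn X n -> TA}) (B : {ffun Xn X n -> TB}) : R := \sum_x W n y x * (collides (likelier x) A B x)%:R.
apply: (@le_trans _ _ (\sum_(A in SA) \sum_(B in SB) pA A * pB B * (a A + d + g A B))).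
  apply: ler_sum => A AS; apply: ler_sum => B BS.
  under eq_bigr => c _ do rewrite -mulrA.
  by rewrite -mulr_sumr ler_wpM2l ?mulr_ge0 ?step.
have -> : \sum_x W n y x * (\sum_(A in SA) \sum_(B in SB)
     pA A * pB B * (collides (likelier x) A B x)%:R) =
    \sum_(A in SA) \sum_(B in SB) pA A * pB B * g A B.
  under eq_bigr => x _ do rewrite mulr_sumr.
  rewrite exchange_big /=; apply: eq_bigr => A _.
  under eq_bigr => x _ do rewrite mulr_sumr.
  rewrite exchange_big /=; apply: eq_bigr => B _.
  by rewrite /g mulr_sumr; apply: eq_bigr => x _; rewrite mulrCA.
have sB A : \sum_(B in SB) pA A * pB B = pA A by rewrite -mulr_sumr ensB.2 mulr1.
under eq_bigr => A _ do (under eq_bigr => B _ do rewrite mulrDr;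
  rewrite big_split /= -mulr_suml sB mulrDr).
by rewrite !big_split /= -mulr_suml ensA.2 mul1r.
Qed.

Local Notation E := (jointP (n:=n) PY W).

Lemma W_le1 y x : W n y x <= 1.
Proof. by rewrite -(W_sum1 y) (bigD1 x) //= lerDl sumr_ge0. Qed.

Lemma muXE x : (mu x)%:E = (\int[PY n]_y (W n y x)%:E)%E.
Proof.
rewrite /muX fineK// ge0_fin_numE; last by apply: integral_ge0 => y _; rewrite lee_fin.
apply: (@le_lt_trans _ _ (\int[PY n]_y 1%:E)%E); last first.
  by rewrite integral_cst_probability ltry.
apply: ge0_le_integral => //.
- by move=> y _; rewrite lee_fin.
- exact/measurable_EFinP.
- by move=> y _; rewrite /= lee_fin W_le1.
Qed.

Lemma muX_ge0 x : 0 <= mu x.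
Proof. by rewrite -lee_fin muXE; apply: integral_ge0 => y _; rewrite lee_fin. Qed.

Lemma measurable_mean (h : Xn X n -> TY n -> R) :
  (forall x, measurable_fun setT (h x)) ->
  measurable_fun setT (fun y => \sum_x W n y x * h x y).
Proof. by move=> mh; apply: measurable_sum => x; apply: measurable_funM. Qed.

Lemma integral_mean (g : Xn X n -> R) : (forall x, 0 <= g x) ->
  (\int[PY n]_y (\sum_x W n y x * g x)%:E = (\sum_x mu x * g x)%:E)%E.
Proof.
move=> g0; under eq_integral => y _ do rewrite -sumEFin.
rewrite ge0_integral_sum//.
- rewrite -sumEFin; apply: eq_bigr => x _.
  under eq_integral => y _ do rewrite mulrC EFinM.
  rewrite ge0_integralZl_EFin// -?muXE 1?mulrC ?EFinM//; last exact/measurable_EFinP.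
  by move=> y _; rewrite lee_fin.
- by move=> x; apply/measurable_EFinP; apply: measurable_funM.
- by move=> x y _; rewrite lee_fin mulr_ge0.
Qed.

Lemma sum_muX : \sum_x mu x = 1.
Proof.
apply: EFin_inj; rewrite -[LHS](_ : (\sum_x mu x * 1)%:E = _); last first.
  by congr EFin; apply: eq_bigr => x _; rewrite mulr1.
rewrite -integral_mean//; under eq_integral => y _.
  under eq_bigr do rewrite mulr1.
  rewrite W_sum1; over.
exact: integral_cst_probability.
Qed.

(** Each point counted has mass at least [mu x], and the masses sum to 1. *)
Lemma likelier_card (x : Xn X n) : (#|likelier x|)%:R * mu x <= 1.
Proof.
rewrite -[leRHS]sum_muX mulr_natl -sumr_const big_mkcond /=; apply: ler_sum => x' _.
by rewrite inE; case: ifP => // _; apply: muX_ge0.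
Qed.

Variables (aA bA aB bB k N eta : R).
Hypothesis N_ge0 : 0 <= N.
Hypotheses (aA_ge0 : 0 <= aA) (aB_ge0 : 0 <= aB).
Hypotheses (hashA : hash_bound SA pA aA bA) (hashB : hash_bound SB pB aB bB).
Variables (T : Xn X n -> TY n -> bool) (S : Xn X n -> bool).
Hypotheses (mT : forall x, measurable_fun setT (T x)) (k_ge0 : 0 <= k)
  (Tk : forall x y, ~~ T x y -> W n y x <= k).
Hypothesis SN : forall x, ~~ S x -> 0 < mu x -> (#|likelier x|)%:R <= N.
Hypothesis eta_gt0 : 0 < eta.

Local Notation MB := ((#|imF SB|)%:R : R).

(** [T] and [S] are the atypical events: off [T] the conditional probability is at most [k], and off
    [S] at most [N] points compete with a possible [x]. For each [y], [mean_err_given_le] and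
    [saturation] bound the mean error by [Phi y]; [exists_le_weighted_mean] then fixes one
    triple. *)
Lemma exists_good_code : exists A B c, [/\ A \in SA, B \in SB, c \in imF SA &
  (Error PY W dist A B c D <= E (fun x y => (D < dist n x y)%R) +
    ((1 + (2 * eta)^-1)%:E * E T + E (fun x _ => S x) +
     (eta / 2 + (`|aA - 1| + (1 + bA) * (MA * k)) / (2 * eta) +
      (bA + bB + aA / MA * (aB / MB) * N))%:E))%E].
Proof.
have pA0 := ensA.1; have pB0 := ensB.1.
pose gam := bA + bB + aA / MA * (aB / MB) * N.
pose C1 := eta / 2 + (`|aA - 1| + (1 + bA) * (MA * k)) / (2 * eta).
pose g x := \sum_(A in SA) \sum_(B in SB) pA A * pB B * (collides (likelier x) A B x)%:R.
pose t y := \sum_x W n y x * (T x y)%:R.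
pose dd y := \sum_x W n y x * (D < dist n x y)%R%:R.
pose Phi y := C1 + (1 + (2 * eta)^-1) * t y + dd y + \sum_x W n y x * g x.
have g0 x : 0 <= g x.
  by apply: sumr_ge0 => A _; apply: sumr_ge0 => B _; rewrite !mulr_ge0.
have g1 x : g x <= 1.
  apply: (@le_trans _ _ (\sum_(A in SA) \sum_(B in SB) pA A * pB B)).
    apply: ler_sum => A _; apply: ler_sum => B _; rewrite ler_piMr ?mulr_ge0//.
    by case: collides.
  under eq_bigr do rewrite -mulr_sumr ensB.2 mulr1.
  by rewrite ensA.2.
have [x0 _] : exists x, 0 < mu x.
  have /psumr_neq0P : \sum_(x : Xn X n) mu x <> 0 by rewrite sum_muX; apply/eqP/oner_neq0.
  by move=> /(_ (fun i _ => muX_ge0 i)) [x /= xw]; exists x.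
have bA0 : 0 <= bA.
  by apply: le_trans _ (hashA x0); apply: sumr_ge0 => ? _; apply: pcoll_ge0.
have bB0 : 0 <= bB.
  by apply: le_trans _ (hashB x0); apply: sumr_ge0 => ? _; apply: pcoll_ge0.
have e20 : 0 <= (2 * eta)^-1 by rewrite invr_ge0 mulr_ge0 ?ltW.
have C10 : 0 <= C1.
  apply: addr_ge0; first by rewrite divr_ge0// ltW.
  by rewrite mulr_ge0// addr_ge0// !mulr_ge0// addr_ge0.
have mT' x : measurable_fun setT (fun y => (T x y)%:R : R) by exact: measurable_natr_bool.
have md x : measurable_fun setT (fun y => (D < dist n x y)%R%:R : R).
  by apply: measurable_natr_bool; apply: measurable_fun_ltr.
have mt : measurable_fun setT t by apply: measurable_mean.
have mdd : measurable_fun setT dd by apply: measurable_mean.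
have mg : measurable_fun setT (fun y => \sum_x W n y x * g x).
  by apply: (@measurable_mean (fun x _ => g x)).
have t0 y : 0 <= t y by apply: sumr_ge0 => x _; rewrite mulr_ge0.
have dd0 y : 0 <= dd y by apply: sumr_ge0 => x _; rewrite mulr_ge0.
have sg0 y : 0 <= \sum_x W n y x * g x by apply: sumr_ge0 => x _; rewrite mulr_ge0.
have mPhi : measurable_fun setT Phi.
  by do !apply: measurable_funD => //; apply: measurable_funM.
pose I := ({ffun Xn X n -> TA} * ({ffun Xn X n -> TB} * TA))%type.
pose Q (i : I) := (i.1 \in SA) && ((i.2.1 \in SB) && (i.2.2 \in imF SA)).
have sumI (F : {ffun Xn X n -> TA} -> {ffun Xn X n -> TB} -> TA -> R) :
    \sum_(i | Q i) F i.1 i.2.1 i.2.2 =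
    \sum_(A in SA) \sum_(B in SB) \sum_(c in imF SA) F A B c.
  under [RHS]eq_bigr => A _ do rewrite pair_big /=.
  by rewrite pair_big.
have [||||//||[A [B c]] /and3P[/= AS BS cS] le] := @exists_le_weighted_mean _ _ _ (PY n) I Q
  (fun i => pA i.1 * pB i.2.1 * MA^-1)
  (fun i => err_given PY W dist i.1 i.2.1 i.2.2 D) Phi.
- by move=> i; rewrite !mulr_ge0.
- rewrite (sumI (fun A B c => pA A * pB B * MA^-1)).
  have mean1 (A : {ffun Xn X n -> TA}) (B : {ffun Xn X n -> TB}) :
      \sum_(c in imF SA) pA A * pB B * MA^-1 = pA A * pB B.
    by rewrite sumr_const -[LHS]mulr_natr divfK ?gt_eqF.
  under eq_bigr => A _ do (under eq_bigr => B _ do rewrite mean1;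
    rewrite -mulr_sumr ensB.2 mulr1).
  exact: ensA.2.
- by move=> i y; apply: err_given_ge0.
- by move=> i; apply: measurable_err_given.
- move=> y; rewrite (sumI (fun A B c => pA A * pB B * MA^-1 * err_given PY W dist A B c D y)).
  apply: le_trans (mean_err_given_le y) _; rewrite lerD2r lerD2r.
  have -> : C1 + (1 + (2 * eta)^-1) * t y = eta / 2 +
    (t y + `|aA - 1| + (1 + bA) * (MA * k)) / (2 * eta) + t y.
    by rewrite /C1; field; rewrite gt_eqF.
  (* [saturation] is used with the complement of [T] as its set [G], so the mass it discards is
     [t y]. *)
  have -> : t y = \sum_(x | ~~ ~~ T x y) W n y x.
    rewrite /t [RHS]big_mkcond; apply: eq_bigr => x _.
    by case: (T x y); rewrite ?mulr1 ?mulr0.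
  by apply: (@saturation _ _ _ _ _ _ _ ensA aA_ge0 hashA (W n y) (fun x => ~~ T x y) k eta) => // x; apply: Tk.
exists A, B, c; split => //; apply: le_trans le _.
have -> : (\int[PY n]_y (Phi y)%:E = C1%:E + (1 + (2 * eta)^-1)%:E * E T
    + E (fun x y => (D < dist n x y)%R) + (\sum_x mu x * g x)%:E)%E.
  have kt0 : 0 <= 1 + (2 * eta)^-1 by rewrite addr_ge0.
  have C1t y : 0 <= C1 + (1 + (2 * eta)^-1) * t y by rewrite addr_ge0// mulr_ge0.
  have mkt : measurable_fun setT (fun y => (1 + (2 * eta)^-1) * t y).
    exact: measurable_funM.
  have mC1t : measurable_fun setT (fun y => C1 + (1 + (2 * eta)^-1) * t y).
    exact: measurable_funD.
  rewrite /Phi ge0_integralD_EFin//; last exact: measurable_funD; last by move=> y; rewrite addr_ge0.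
  rewrite ge0_integralD_EFin// (@ge0_integralD_EFin _ _ _ _ (fun=> C1))//; last first.
    by move=> y; rewrite mulr_ge0.
  rewrite integral_cst_probability integral_mean//; congr (_ + _ + _ + _)%E.
  under eq_integral => y _ do rewrite EFinM.
  rewrite ge0_integralZl_EFin// => [y _|]; rewrite ?lee_fin//; exact/measurable_EFinP.
(* On [S] the collision probability is bounded by 1, off [S] by [gam]. Points with [mu x = 0] have
   too many competitors for [SN], but carry no weight. *)
have gle : \sum_x mu x * g x <= \sum_x mu x * (S x)%:R + gam.
  have -> : gam = \sum_x mu x * gam by rewrite -mulr_suml sum_muX mul1r.
  rewrite -big_split /=; apply: ler_sum => x _; rewrite -mulrDr.
  have := muX_ge0 x; rewrite le_eqVlt => /orP[/eqP <-|mx]; first by rewrite !mul0r.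
  rewrite ler_pM2l//; case: (boolP (S x)) => Sx.
    rewrite (le_trans (g1 x))// lerDl !addr_ge0//.
    by rewrite !mulr_ge0// invr_ge0.
  rewrite add0r; apply: le_trans (collision_prob_le _ _ _ _ hashA hashB _ _) _ => //.
  by rewrite lerD2l ler_wpM2l ?SN// !mulr_ge0// invr_ge0.
have -> : E (fun x _ => S x) = (\sum_x mu x * (S x)%:R)%:E by exact: (@integral_mean (fun x => (S x)%:R)).
rewrite -/C1 -/gam; move: gle; move: (C1) (gam) (E _) (E _) => C gamma eD eT gle.
apply: (@le_trans _ _ (C%:E + (1 + (2 * eta)^-1)%:E * eT + eD +
    (\sum_x mu x * (S x)%:R + gamma)%:E)%E); first by rewrite leeD2l// lee_fin.
rewrite le_eqVlt; apply/orP; left; apply/eqP.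
rewrite !EFinD [LHS]addeAC [LHS]addeC; congr (_ + _)%E.
by rewrite [X in (X + _ = _)%E]addeC addeACA.
Qed.

End FixedBlocklength.

(** * From normalized logarithms to exponentials *)

Section Rates.
Context {R : realType}.

Lemma ln2_gt0 : 0 < ln 2 :> R.
Proof. by rewrite ln_gt0// ltr1n. Qed.

(* At [w = 0] both sides are 0, by the conventions [0^-1 = 0] and [ln 0 = 0]. *)
Lemma log2V (w : R) : 0 <= w -> log2 w^-1 = - (ln w / ln 2).
Proof.
rewrite /log2 le_eqVlt => /orP[/eqP <-|w0]; first by rewrite invr0 ln0// mul0r oppr0.
by rewrite lnV// mulNr.
Qed.

Lemma le_expR_log2V (n : nat) (th w : R) : (0 < n)%N -> 0 <= w ->
  ~~ (n%:R^-1 * log2 w^-1 < th) -> w <= expR (n%:R * - th * ln 2).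
Proof.
move=> n0 w0; rewrite -leNgt log2V// => le.
(* At [w = 0] the default value of the logarithm makes the hypothesis uninformative, but the bound
   is trivial. *)
have [->|wn0] := eqVneq w 0; first exact: expR_ge0.
have wp : 0 < w by rewrite lt0r wn0.
rewrite -[leLHS]lnK// ler_expR mulrN mulNr lerNr.
move: le; rewrite ler_pdivlMl ?ltr0n// -mulNr ler_pdivlMr ?ln2_gt0//.
Qed.

Lemma ge_expR_log2V (n : nat) (th w : R) : (0 < n)%N -> 0 < w ->
  ~~ (th < n%:R^-1 * log2 w^-1) -> w^-1 <= expR (n%:R * th * ln 2).
Proof.
move=> n0 wp; rewrite -leNgt log2V; last exact: ltW.
rewrite ler_pdivrMl ?ltr0n// -mulNr ler_pdivrMr ?ln2_gt0//.
by move=> le; rewrite -[leLHS]lnK ?posrE ?invr_gt0// ler_expR lnV.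
Qed.

Lemma expR_log2_rate (n M : nat) (r : R) : (0 < n)%N -> 0 < r ->
  n%:R^-1 * log2 M%:R = r -> M%:R = expR (n%:R * r * ln 2).
Proof.
(* [M = 0] would give rate 0 by the convention [ln 0 = 0]; positivity of [r] excludes it. *)
move=> n0 r0; case: M => [|M]; first by rewrite /log2 ln0// mul0r mulr0 => /eqP; rewrite lt_eqF.
move=> <-; rewrite mulrA divff ?mul1r ?pnatr_eq0 -?lt0n//.
by rewrite /log2 divfK ?gt_eqF ?ln2_gt0// lnK// posrE.
Qed.

Lemma cvg_expR_linear (c : R) : c < 0 -> expR (n%:R * c * ln 2) @[n --> \oo] --> (0 : R).
Proof.
move=> c0; have -> : (fun n : nat => expR (n%:R * c * ln 2)) = (fun n => expR (c * ln 2) ^+ n).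
  by apply/funext => n; rewrite -mulrA expRM_natl.
apply: cvg_expr; rewrite ger0_norm ?expR_ge0// expR_lt1.
by rewrite nmulr_rlt0// ln2_gt0.
Qed.

End Rates.

Lemma measurable_log2V {R : realType} d (T : measurableType d) (f : T -> R) :
  (forall y, 0 <= f y) -> measurable_fun setT f ->
  measurable_fun setT (fun y => log2 (f y)^-1).
Proof.
move=> f0 mf; under eq_fun do rewrite log2V// -mulNr.
apply: measurable_funM => //; apply: measurable_funN.
exact: measurableT_comp (@measurable_ln R) mf.
Qed.

(** * Letting the blocklength grow *)

Theorem theorem2 (R : realType) (X : finType)
  (dY : nat -> measure_display) (TY : forall n, measurableType (dY n))
  (PY : forall n, probability (TY n) R)
  (W : forall n, TY n -> Xn X n -> R)
  (W_ge0 : forall n y x, 0 <= W n y x)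
  (W_sum1 : forall n y, \sum_(x : Xn X n) W n y x = 1)
  (W_meas : forall n x, measurable_fun setT (fun y => W n y x))
  (dist : forall n, Xn X n -> TY n -> R)
  (dist_ge0 : forall n x y, 0 <= dist n x y)
  (dist_meas : forall n x, measurable_fun setT (dist n x))
  (D : R) (D_ge0 : 0 <= D)
  (TA TB : nat -> finType)
  (SA : forall n, {set {ffun Xn X n -> TA n}}) (pA : forall n, {ffun Xn X n -> TA n} -> R)
  (SB : forall n, {set {ffun Xn X n -> TB n}}) (pB : forall n, {ffun Xn X n -> TB n} -> R)
  (ensA : forall n, is_ensemble (SA n) (pA n))
  (ensB : forall n, is_ensemble (SB n) (pB n))
  (hashA : has_hash_property SA pA) (hashB : has_hash_property SB pB)
  (r Rt : R) (r_gt0 : 0 < r) (Rt_gt0 : 0 < Rt)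
  (rateA : forall n, (0 < n)%N -> n%:R^-1 * log2 (#|imF (SA n)|)%:R = r)
  (rateB : forall n, (0 < n)%N -> n%:R^-1 * log2 (#|imF (SB n)|)%:R = Rt)
  (Hr : (r%:E < Hlow PY W)%E)
  (HrR : (Hbar PY W < (r + Rt)%:E)%E) :
  forall delta : R, 0 < delta ->
  exists N : nat, forall n : nat, (N <= n)%N ->
    exists (A : {ffun Xn X n -> TA n}) (B : {ffun Xn X n -> TB n}) (c : TA n),
      [/\ A \in SA n, B \in SB n, c \in imF (SA n) &
          (Error PY W dist A B c D <=
             jointP (n:=n) PY W (fun x y => (D < dist n x y)%R) + delta%:E)%E].
Proof.
move=> delta delta0.
(* The strict inequalities leave room for thresholds with [r < th] and [th' < r + Rt] whose atypical
   events have vanishing probability. *)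
have /ereal_sup_gt[_ [th Hth <-]] := Hr; rewrite lte_fin => rth.
have /ereal_inf_lt[_ [th' Hth' <-]] := HrR; rewrite lte_fin => thr.
have [alA [beA [alA1 beA0 hA]]] := hashA.
have [alB [beB [alB1 beB0 hB]]] := hashB.
pose kap : R := 1 + (2 * delta)^-1.
pose t n := jointP (n:=n) PY W (fun x y => n%:R^-1 * log2 (W n y x)^-1 < th).
pose s n := jointP (n:=n) PY W (fun x _ => th' < n%:R^-1 * log2 (muX (n:=n) PY W x)^-1).
have /fine_cvgP[tfin tlim] : t n @[n --> \oo] --> 0%:E := Hth.
have /fine_cvgP[sfin slim] : s n @[n --> \oo] --> 0%:E := Hth'.
(* The excess in [exists_good_code] for [eta = delta], [k = 2^(-n th)] and [N = 2^(n th')], apart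
   from the constant [eta / 2]. It remains to make [v n] smaller than the other half of [delta]. The
   two exponentials are [MA * k] and [N / (MA * MB)]. *)
pose v n : R := kap * fine (t n) + fine (s n) +
  ((`| `|alA n| - 1| + (1 + beA n) * expR (n%:R * (r - th) * ln 2)) / (2 * delta) +
   (beA n + beB n + `|alA n| * `|alB n| * expR (n%:R * (th' - (r + Rt)) * ln 2))).
have vlim : v n @[n --> \oo] --> (0 : R).
  have e1 : expR (n%:R * (r - th) * ln 2) @[n --> \oo] --> (0 : R).
    by apply: cvg_expR_linear; rewrite subr_lt0.
  have e2 : expR (n%:R * (th' - (r + Rt)) * ln 2) @[n --> \oo] --> (0 : R).
    by apply: cvg_expR_linear; rewrite subr_lt0.
  have a1 : `|alA n| @[n --> \oo] --> (1 : R) by rewrite -[1]normr1; apply: cvg_norm.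
  have a2 : `|alB n| @[n --> \oo] --> (1 : R) by rewrite -[1]normr1; apply: cvg_norm.
  have -> : (0 : R) = kap * 0 + 0 + ((`|1 - 1| + (1 + 0) * 0) / (2 * delta) +
    (0 + 0 + 1 * 1 * 0)) by rewrite subrr normr0 !(mulr0, addr0, mul0r).
  apply: cvgD; first by apply: cvgD => //; apply: cvgM => //; apply: cvg_cst.
  apply: cvgD.
    apply: cvgM; last exact: cvg_cst.
    apply: cvgD; first by apply: cvg_norm; apply: cvgB => //; apply: cvg_cst.
    by apply: cvgM => //; apply: cvgD => //; apply: cvg_cst.
  by apply: cvgD; [apply: cvgD | apply: cvgM => //; apply: cvgM].
have d2 : 0 < delta / 2 by rewrite divr_gt0.
have vlt : \forall n \near \oo, v n < delta / 2 by exact: cvgr_lt vlim _ d2.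
have [N _ HN] : \forall n \near \oo,
    [/\ t n \is a fin_num, s n \is a fin_num & v n < delta / 2].
  by apply: filterS3 _ tfin sfin vlt => n; split.
(* The rates of the ensembles are prescribed only for [n > 0]. *)
exists (maxn N 1) => n; rewrite geq_max => /andP[Nn n0].
have [tn sn vn] := HN n Nn.
have MAE := expR_log2_rate n0 r_gt0 (rateA n n0).
have MBE := expR_log2_rate n0 Rt_gt0 (rateB n n0).
have [] := @exists_good_code R X dY TY PY W W_ge0 W_sum1 W_meas dist dist_meas n
  (TA n) (TB n) D (SA n) (pA n) (SB n) (pB n) (ensA n) (ensB n) _
  `|alA n| (beA n) `|alB n| (beB n) (expR (n%:R * - th * ln 2))
  (expR (n%:R * th' * ln 2)) delta _ _ _ _ _
  (fun x y => n%:R^-1 * log2 (W n y x)^-1 < th)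
  (fun x => th' < n%:R^-1 * log2 (muX (n:=n) PY W x)^-1) => //.
- by rewrite MAE expR_gt0.
- exact: (hash_bound_norm (ensA n) _ (hA n)).
- exact: (hash_bound_norm (ensB n) _ (hB n)).
- move=> x; apply: measurable_fun_ltr => //; apply: measurable_funM => //.
  exact: measurable_log2V.
- by move=> x y; apply: le_expR_log2V.
(* The number of competitors is at most [1 / mu x], which is at most [2^(n th')] off the atypical
   event. *)
- move=> x Sx mx; apply: le_trans (ge_expR_log2V n0 mx Sx).
  by rewrite -div1r ler_pdivlMr// likelier_card.
move=> A [B [c [AS BS cS le]]]; exists A, B, c; split => //.
apply: le_trans le _; apply: leeD2l.
rewrite -[X in (_ * X + _ + _)%E]/(t n) -[X in (_ + X + _)%E]/(s n).
rewrite -(fineK tn) -(fineK sn) -EFinM -!EFinD lee_fin.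
rewrite MAE MBE.
have -> : (1 + beA n) * (expR (n%:R * r * ln 2) * expR (n%:R * - th * ln 2)) =
    (1 + beA n) * expR (n%:R * (r - th) * ln 2).
  by rewrite -expRD; congr (_ * expR _); ring.
have -> : `|alA n| / expR (n%:R * r * ln 2) * (`|alB n| / expR (n%:R * Rt * ln 2)) *
   expR (n%:R * th' * ln 2) = `|alA n| * `|alB n| * expR (n%:R * (th' - (r + Rt)) * ln 2).
  rewrite -!expRN mulrACA -[LHS]mulrA -!expRD; congr (_ * expR _); ring.
move: vn; rewrite /v -/kap; lra.
Qed.
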